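(* Let $\pi$ be a permutation avoiding both $312$ and $321$. Then the number of alternating sign matrices whose SW key is $\pi$ is a product of Catalan numbers. In particular, if $\pi=w_{m_1}\oplus w_{m_2}\oplus\dots\oplus w_{m_k}$, then the number of ASMs whose SW key is $\pi$ equals $\prod_{i=1}^k C_{m_i-1}$, where $C_m=\frac{1}{m+1}\binom{2m}{m}$.
   Context: An alternating sign matrix (ASM) of size $n$ is an $n\times n$ matrix with entries in $\{0,1,-1\}$ such that every row and every column sums to $1$ and the nonzero entries of each row and of each column alternate in sign. Position $(i,j)$ is the $i$-th row from the top and $j$-th column from the left. The permutation matrix of $\sigma=\sigma(1)\dots\sigma(n)$ has a $1$ in row $i$, column $\sigma(i)$ for each $i$; permutations are identified with their permutation matrices. A permutation $\sigma$ contains $\pi=\pi(1)\dots\pi(k)$ if there are indices $i_1<\dots<i_k$ with $\sigma(i_a)<\sigma(i_b)$ iff $\pi(a)<\pi(b)$; otherwise $\sigma$ avoids $\pi$. SW key process: a $-1$ entry is removable if no other $-1$ entry lies weakly southwest of it (weakly below and weakly to the left). For a removable $-1$ at $(i,j)$, let $(i,j_0)$ be the nearest $1$ to its west in its row and $(i_0,j)$ the nearest $1$ below it in its column; its neighboring $1$s are the $1$ entries weakly southwest of it such that no other $1$ entry lies both weakly northeast of them and weakly southwest of the $-1$. Consider the $1$s at $(i,j_0)$, $(i_0,j)$ and the neighboring $1$s lying in the rectangle of rows $i..i_0$ and columns $j_0..j$. Replace the south-most of these $1$s by $0$; then moving east to west, for each subsequent one of these $1$s, in column $c$ say, place a new $1$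 in the row of the previously replaced $1$ and column $c$, and replace the old $1$ in column $c$ by $0$; finally replace the $-1$ by $0$. Repeating until no $-1$ remains yields a permutation matrix, independent of the order of removals, called the SW key of $A$. For matrices $A,B$, the direct sum is $A\oplus B=\begin{pmatrix}A&0\\0&B\end{pmatrix}$. For $n\ge1$, $w_n$ denotes the permutation $23\dots n1$ (so $w_1=1$). *)

(* Defs.v *)
From mathcomp Require Import all_boot all_order all_algebra all_fingroup.
From mathcomp Require Import classical_sets cardinality.

Set Implicit Arguments.
Unset Strict Implicit.
Unset Printing Implicit Defensive.

Import Order.TTheory GRing.Theory Num.Theory.
Local Open Scope ring_scope.

Definition alternating (s : seq int) : bool :=
  sorted (fun x y => x * y < 0) [seq x <- s | x != 0].

Definition is_asm (n : nat) (A : 'M[int]_n) : Prop :=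
  [/\ forall i j, A i j \in [:: 0; 1; -1],
      forall i, \sum_j A i j = 1,
      forall j, \sum_i A i j = 1,
      forall i, alternating [seq A i j | j <- enum 'I_n] &
      forall j, alternating [seq A i j | i <- enum 'I_n]].

(* A cell is a pair (row, column), counted from 0 at the top left corner,
   so larger rows are further south and larger columns further east. *)
Notation cell n := ('I_n * 'I_n)%type (only parsing).

Definition entry (n : nat) (A : 'M[int]_n) (p : cell n) : int := A p.1 p.2.

Definition weakly_sw (n : nat) (q p : cell n) : bool :=
  (p.1 <= q.1)%N && (q.2 <= p.2)%N.

Definition removable (n : nat) (A : 'M[int]_n) (p : cell n) : bool :=
  (entry A p == -1) &&
  [forall q, (entry A q == -1) && weakly_sw q p ==> (q == p)].

Definition nearest_west (n : nat) (A : 'M[int]_n) (p : cell n) (j0 : 'I_n) :=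
  [&& (j0 < p.2)%N, A p.1 j0 == 1 &
      [forall c : 'I_n, (j0 < c < p.2)%N ==> (A p.1 c != 1)]].

Definition nearest_south (n : nat) (A : 'M[int]_n) (p : cell n) (i0 : 'I_n) :=
  [&& (p.1 < i0)%N, A i0 p.2 == 1 &
      [forall r : 'I_n, (p.1 < r < i0)%N ==> (A r p.2 != 1)]].

(* [weakly_sw q r] says that r is weakly northeast of q. *)
Definition neighboring (n : nat) (A : 'M[int]_n) (p q : cell n) : bool :=
  [&& entry A q == 1, weakly_sw q p &
      [forall r, [&& entry A r == 1, weakly_sw q r & weakly_sw r p]
                   ==> (r == q)]].

Definition involved (n : nat) (A : 'M[int]_n) (p q : cell n) : bool :=
  [exists i0, exists j0,
    [&& nearest_south A p i0, nearest_west A p j0 &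
     [|| q == (p.1, j0), q == (i0, p.2) |
      [&& neighboring A p q, (p.1 <= q.1 <= i0)%N & (j0 <= q.2 <= p.2)%N]]]].

(* For a removable -1 of an ASM, the involved 1s form an antichain for
   [weakly_sw], so they lie in distinct columns and, from east to west, their
   rows strictly decrease: the head of this list is the south-most one. *)
Definition involved_seq (n : nat) (A : 'M[int]_n) (p : cell n) : seq (cell n) :=
  sort (fun q r : cell n => (r.2 <= q.2)%N)
       [seq q <- enum {: cell n} | involved A p q].

Definition set_entry (n : nat) (A : 'M[int]_n) (p : cell n) (x : int) :
    'M[int]_n :=
  \matrix_(i, j) if (i, j) == p then x else A i j.

(* r is the row of the 1 replaced last. *)
Fixpoint shift_ones (n : nat) (A : 'M[int]_n) (r : 'I_n) (s : seq (cell n)) :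
    'M[int]_n :=
  if s is q :: s' then
    shift_ones (set_entry (set_entry A (r, q.2) 1) q 0) q.1 s'
  else A.

Definition sw_remove (n : nat) (A : 'M[int]_n) (p : cell n) : 'M[int]_n :=
  let B := if involved_seq A p is q :: s
           then shift_ones (set_entry A q 0) q.1 s else A in
  set_entry B p 0.

(* [sw_key A B]: some sequence of removals, each of a removable -1, leads from
   A to the matrix B without any -1. For an ASM A, B exists and does not depend
   on the sequence chosen. *)
Inductive sw_key (n : nat) : 'M[int]_n -> 'M[int]_n -> Prop :=
| sw_key_done (A : 'M[int]_n) : (forall p, entry A p <> -1) -> sw_key A A
| sw_key_step (A B : 'M[int]_n) (p : cell n) :
    removable A p -> sw_key (sw_remove A p) B -> sw_key A B.

Definition asms_with_sw_key (n : nat) (pi : 'S_n) : set 'M[int]_n :=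
  [set A | is_asm A /\ sw_key A (perm_mx pi)]%classic.

(* The pattern w is given in one-line notation. *)
Definition contains (n : nat) (s : 'S_n) (w : seq nat) : Prop :=
  exists f : 'I_(size w) -> 'I_n,
    (forall a b : 'I_(size w), (a < b)%N -> (f a < f b)%N) /\
    (forall a b : 'I_(size w),
       (s (f a) < s (f b))%N = (nth 0%N w a < nth 0%N w b)%N).

Definition avoids (n : nat) (s : 'S_n) (w : seq nat) : Prop := ~ contains s w.

(* 23...n1 in one-line notation: i |-> i + 1 modulo n. *)
Definition wperm (n : nat) : 'S_n := perm (@ordS_inj n).

Definition catalan (m : nat) : nat := ('C(m.*2, m) %/ m.+1)%N.

(* Main.v *)
Require Import Defs.
From mathcomp Require Import all_boot all_order all_algebra all_fingroup.
From mathcomp Require Import classical_sets cardinality.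
From mathcomp Require Import zify.

(* Count rows and columns from 0. If pi avoids 312 and 321 then pi(k) <= k+1, so
   its matrix vanishes above the superdiagonal. Removals only touch cells weakly
   southwest of the removed -1, and every -1 has a 1 further east in its row, so
   a 1 above the superdiagonal can never be cleared: an ASM with key pi vanishes
   above the superdiagonal as well. Such an ASM has row i equal to
   e_{l(i)} - e_{l(i+1)} + e_{i+1} for a unique nondecreasing l with l(k) <= k
   and l(n) = n. Removing its -1 in row i resets l to l(i) on the maximal run
   of indices k > i where l(k) = l(i+1), which does not change the set
   D = {k | l(k) = k}; and when no -1 is left, l is determined by D. So the ASMs
   with key pi correspond to the l with a prescribed D, and between consecutive
   elements of D at distance m there are catalan (m - 1) choices. *)

Set Implicit Arguments.
Unset Strict Implicit.
Unset Printing Implicit Defensive.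

Import Order.TTheory GRing.Theory Num.Theory.
Local Open Scope ring_scope.

(** * Prefix sums and sign alternation *)

Definition psum (n : nat) (F : 'I_n -> int) (k : nat) : int :=
  \sum_(j < n | (j < k)%N) F j.

Lemma psum0 (n : nat) (F : 'I_n -> int) : psum F 0 = 0.
Proof. by rewrite /psum big_pred0. Qed.

Lemma psumS (n : nat) (F : 'I_n -> int) (k : 'I_n) :
  psum F k.+1 = psum F k + F k.
Proof.
rewrite /psum (bigD1 k) //= addrC; congr (_ + _); apply: eq_bigl => j.
by rewrite -(inj_eq val_inj) /=; lia.
Qed.

Lemma psum_full (n : nat) (F : 'I_n -> int) (k : nat) :
  (n <= k)%N -> psum F k = \sum_j F j.
Proof. by move=> nk; apply: eq_bigl => j; rewrite (leq_trans (ltn_ord j)). Qed.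

Lemma psum_eq (n : nat) (F : 'I_n -> int) (G : nat -> int) :
  G 0%N = 0 -> (forall k : 'I_n, G k.+1 = G k + F k) ->
  forall k, (k <= n)%N -> psum F k = G k.
Proof.
move=> G0 GS; elim=> [|k IHk] ltkn; first by rewrite psum0 G0.
by rewrite (psumS F (Ordinal ltkn)) IHk ?(ltnW ltkn) // (GS (Ordinal ltkn)).
Qed.

Lemma take_map_enum (T : Type) (n : nat) (F : 'I_n -> T) (k : nat) :
  take k [seq F j | j <- enum 'I_n]
  = map F [seq j : 'I_n <- enum 'I_n | (j < k)%N].
Proof.
rewrite -map_take; congr map; apply: (inj_map val_inj).
rewrite map_take -(filter_map val (fun j : nat => (j < k)%N)) val_enum_ord.
case: (leqP k n) => [lekn|/ltnW lenk]; first last.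
  rewrite take_oversize ?size_iota //; apply/esym/all_filterP/allP => j.
  by rewrite mem_iota; lia.
by rewrite take_iota (minn_idPl lekn) -[in RHS](add0n k) filter_iota_ltn.
Qed.

Lemma psum_take (n : nat) (F : 'I_n -> int) (k : nat) :
  \sum_(x <- take k [seq F j | j <- enum 'I_n]) x = psum F k.
Proof. by rewrite take_map_enum big_map big_filter big_enum_cond. Qed.

(** The running total is a state in {0, 1} that records the last sign: 1 after a 1, 0 after a -1. It
    stays in {0, 1} exactly when each nonzero entry flips it. *)
Lemma path_opposite_prefix (c : bool) (s : seq int) :
  all (fun x => x \in [:: 0; 1; -1]) s ->
  path (fun x y => x * y < 0) (if c then 1 else -1) [seq x <- s | x != 0] <->
  (forall k, 0 <= Posz c + \sum_(x <- take k s) x <= 1).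
Proof.
elim: s c => [|x s IHs] c /=.
  by move=> _; split=> // _ k; rewrite big_nil; case: c.
case/andP; rewrite !inE => xP sP.
have shift (d : bool) : x = Posz d - Posz c ->
    (forall k, 0 <= Posz d + \sum_(x <- take k s) x <= 1) <->
    (forall k, 0 <= Posz c + \sum_(x <- take k (x :: s)) x <= 1).
  move=> xE; split=> H k.
    case: k => [|k] /=; first by rewrite big_nil; case: (c).
    by have := H k; rewrite big_cons xE; move: (\sum_(_ <- _) _) => S; lia.
  by have := H k.+1; rewrite /= big_cons xE; lia.
case/or3P: xP => /eqP xE.
- by rewrite -(shift c) ?xE ?subrr // -IHs.
- case: c shift => shift; last by rewrite -(shift true) // -IHs // xE.
  by split=> [|/(_ 1%N)]; rewrite xE //= take0 big_seq1.
- case: c shift => shift; first by rewrite -(shift false) // -IHs // xE.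
  by split=> [|/(_ 1%N)]; rewrite xE //= take0 big_seq1.
Qed.

(* A sign sequence of sum 1 cannot start with -1, so it may be prefixed by a
   virtual -1. *)
Lemma alternating_prefix (s : seq int) :
  all (fun x => x \in [:: 0; 1; -1]) s -> \sum_(x <- s) x = 1 ->
  alternating s <-> (forall k, 0 <= \sum_(x <- take k s) x <= 1).
Proof.
move=> sP s1; transitivity (forall k, 0 <= Posz false + \sum_(x <- take k s) x <= 1).
  rewrite -(path_opposite_prefix false sP) /alternating.
  split; last by case: [seq _ <- _ | _] => //= ? ? /andP[].
  elim: s sP s1 => //= x s IHs /andP[xP sP]; rewrite big_cons.
  move: xP; rewrite !inE => /or3P[]/eqP-> //=.
    by rewrite add0r; exact: IHs.
  move=> s1 /(proj1 (path_opposite_prefix false sP))/(_ (size s)).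
  by rewrite take_size; move: (\sum_(_ <- _) _) s1 => S; lia.
by split=> H k; have := H k; rewrite add0r.
Qed.

Lemma alternating_psum (n : nat) (F : 'I_n -> int) :
  (forall j, F j \in [:: 0; 1; -1]) -> \sum_j F j = 1 ->
  alternating [seq F j | j <- enum 'I_n] <-> (forall k, 0 <= psum F k <= 1).
Proof.
move=> FP F1; rewrite alternating_prefix.
- by split=> H k; have := H k; rewrite psum_take.
- by apply/allP => _ /mapP[j _ ->].
- by rewrite big_map big_enum.
Qed.

(** The condition on single entries is absorbed: an entry is the difference of two consecutive
    prefix sums, both in {0, 1}. *)
Lemma is_asm_psum (n : nat) (A : 'M[int]_n) :
  is_asm A <->
  [/\ forall i, \sum_j A i j = 1, forall j, \sum_i A i j = 1,
      forall i k, 0 <= psum (A i) k <= 1 &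
      forall j k, 0 <= psum (A^~ j) k <= 1].
Proof.
split=> [[A01 Ar Ac Aar Aac]|[Ar Ac Apr Apc]].
  by split=> // i; apply/alternating_psum.
have A01 i j : A i j \in [:: 0; 1; -1].
  have := Apr i j; have := Apr i j.+1; rewrite psumS !inE; lia.
by split=> // i; apply/alternating_psum.
Qed.

(** * ASMs encoded by nondecreasing sequences *)

(* Row [i] is [e_(l i) - e_(l i.+1) + e_(i.+1)]; a column index [n] lies outside
   the matrix. *)
Definition asm_of (n : nat) (l : nat -> nat) : 'M[int]_n :=
  \matrix_(i, j)
    (Posz (j == l i :> nat) - Posz (j == l i.+1 :> nat) + Posz (j == i.+1 :> nat)).

Definition admissible (n : nat) (l : nat -> nat) : Prop :=
  [/\ l n = n, forall i, (i <= n)%N -> (l i <= i)%N &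
      forall i, (i < n)%N -> (l i <= l i.+1)%N].

Lemma admissible_le (n : nat) (l : nat -> nat) : admissible n l ->
  forall i j, (i <= j <= n)%N -> (l i <= l j)%N.
Proof.
case=> _ _ lS i j /andP[ij jn]; rewrite -(subnKC ij).
have {jn}: (i + (j - i) <= n)%N by lia.
elim: (j - i)%N => [|d IHd]; first by rewrite addn0.
by rewrite addnS => H; apply: leq_trans (IHd (ltnW H)) (lS _ H).
Qed.

Lemma asm_of_row_psum (n : nat) (l : nat -> nat) (i : 'I_n) (k : nat) :
  (k <= n)%N ->
  psum (asm_of n l i) k = Posz (l i < k) - Posz (l i.+1 < k) + Posz (i.+1 < k).
Proof.
move: k; apply: psum_eq => [|k]; rewrite ?mxE; first by lia.
lia.
Qed.

(** Down a column the sums telescope: the term [- e_(l i.+1)] of row [i] cancels the first term of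
    row [i.+1]. *)
Lemma asm_of_col_psum (n : nat) (l : nat -> nat) (j : 'I_n) (k : nat) :
  l 0%N = 0%N -> (k <= n)%N ->
  psum (asm_of n l ^~ j) k = Posz (j <= k) - Posz (j == l k :> nat).
Proof.
move=> l0; move: k; apply: psum_eq => [|k]; rewrite ?mxE ?l0; lia.
Qed.

Lemma psum_minn (n : nat) (F : 'I_n -> int) (k : nat) :
  psum F k = psum F (minn k n).
Proof. by apply: eq_bigl => j; have := ltn_ord j; lia. Qed.

Lemma asm_of_is_asm (n : nat) (l : nat -> nat) :
  admissible n l -> is_asm (asm_of n l).
Proof.
move=> [ln lle lS]; have l0 : l 0%N = 0%N by have := lle 0%N isT; lia.
apply/is_asm_psum; split=> [i|j|i k|j k].
- rewrite -(psum_full _ (leqnn n)) asm_of_row_psum //.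
  have := lS _ (ltn_ord i); have := lle _ (ltn_ord i).
  have := lle _ (ltnW (ltn_ord i)); have := ltn_ord i.
  have lSn : i.+1 = n -> l i.+1 = n by move=> ->.
  by case: (eqVneq i.+1 n) => [E|]; first have := lSn E; lia.
- by rewrite -(psum_full _ (leqnn n)) asm_of_col_psum // ln; have := ltn_ord j; lia.
- rewrite psum_minn asm_of_row_psum ?geq_minr //.
  have := lS _ (ltn_ord i); have := lle _ (ltn_ord i); lia.
- rewrite psum_minn asm_of_col_psum ?geq_minr //.
  have := lle _ (geq_minr k n); lia.
Qed.

(** [l k] is recovered as the only column in [0..k] whose sum over the first [k] rows vanishes. *)
Lemma asm_of_inj (n : nat) (l l' : nat -> nat) :
  admissible n l -> admissible n l' -> asm_of n l = asm_of n l' ->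
  forall k, (k < n)%N -> l k = l' k.
Proof.
move=> al al' E k kn.
have [ln lle lS] := al; have [ln' lle' lS'] := al'.
have l0 : l 0%N = 0%N by have := lle 0%N isT; lia.
have l0' : l' 0%N = 0%N by have := lle' 0%N isT; lia.
have lk : (l k < n)%N by have := lle _ (ltnW kn); lia.
have := asm_of_col_psum (Ordinal lk) l0 (ltnW kn).
have := asm_of_col_psum (Ordinal lk) l0' (ltnW kn).
by rewrite -E => -> /=; have := lle _ (ltnW kn); lia.
Qed.

(** * ASMs that vanish above the superdiagonal *)

Lemma sum01_eq1 (n : nat) (F : 'I_n -> int) :
  (forall j, 0 <= F j <= 1) -> \sum_j F j = 1 ->
  exists x : 'I_n, forall j, F j = Posz (j == x).
Proof.
move=> F01 F1.
have [x Fx] : exists x, F x != 0.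
  apply/existsP; apply: contraPT isT; rewrite negb_exists => /forallP F0.
  by move: F1; rewrite big1 // => j _; apply/eqP; have := F0 j; rewrite negbK.
exists x => j; case: eqVneq => [->|jx]; first by have := F01 x; lia.
move: F1; rewrite (bigD1 x) //= => F1.
have S0 : \sum_(j | j != x) F j = 0.
  apply: le_anti; rewrite sumr_ge0 ?andbT => [|k _]; last by case/andP: (F01 k).
  have := F01 x; move: (\sum_(_ | _) _) F1 => S; lia.
by apply: (psumr_eq0P _ S0) => // k _; case/andP: (F01 k).
Qed.

(** The prefix sum that ends with the -1 is 0 while the whole row sums to 1, so a positive entry
    lies further east. *)
Lemma asm_one_east (n : nat) (A : 'M[int]_n) (i j : 'I_n) :
  is_asm A -> A i j = -1 -> exists2 j' : 'I_n, (j < j')%N & A i j' = 1.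
Proof.
case/is_asm_psum => Ar _ Apr _ Aij.
have [j' jj' Aij'] : exists2 j' : 'I_n, (j < j')%N & 0 < A i j'.
  suff /existsP[j' /andP[]] : [exists j' : 'I_n, (j < j')%N && (0 < A i j')].
    by exists j'.
  apply: contraPT isT; rewrite negb_exists => /forallP H.
  have : \sum_k A i k <= psum (A i) j.+1.
    rewrite (bigID [pred k : 'I_n | (k < j.+1)%N]) /= gerDl.
    by apply: sumr_le0 => k kj; have := H k; lia.
  by rewrite Ar psumS Aij; have := Apr i j; lia.
exists j' => //.
by have := Apr i j'; have := Apr i j'.+1; rewrite psumS; lia.
Qed.

Definition hessenberg (n : nat) (A : 'M[int]_n) : Prop :=
  forall i j : 'I_n, (i.+1 < j)%N -> A i j = 0.

(* After [i] rows, the column sums are 1 on the first [i.+1] columns except for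
   a single one, which is [l i]. *)
Lemma hessenberg_asm (n : nat) (A : 'M[int]_n) :
  is_asm A -> hessenberg A -> exists2 l, admissible n l & A = asm_of n l.
Proof.
case/is_asm_psum => Ar Ac Apr Apc hA.
pose c k j := psum (A^~ j) k.
(* The default [n] is taken at [k = n], where every column sum is already 1. *)
pose l k := oapp (@nat_of_ord n) n [pick j : 'I_n | (j <= k)%N && (c k j == 0)].
have cn j : c n j = 1 by rewrite /c psum_full.
have ln : l n = n.
  by rewrite /l; case: pickP => //= j; rewrite cn andbF.
have cE k : (k < n)%N ->
    (l k <= k)%N /\ forall j : 'I_n, c k j = Posz (j <= k) - Posz (j == l k :> nat).
  move=> kn.
  have c0 (j : 'I_n) : (k < j)%N -> c k j = 0.
    by move=> kj; apply: big1 => i ik; apply: hA; lia.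
  (* The defects [(j <= k) - c k j] are 0 or 1. They add up to [k.+1 - k = 1], since each of the
     first [k] rows sums to 1. *)
  have [||x xE] := @sum01_eq1 n (fun j => Posz (j <= k) - c k j).
  - by move=> j; have := Apc j k; rewrite -/(c k j); have := c0 j; lia.
  - rewrite sumrB /c exchange_big /=.
    rewrite [X in _ - X](eq_bigr (fun => 1)) => [|i _]; last exact: Ar.
    have count m : (m <= n)%N -> \sum_(i < n | (i < m)%N) (1 : int) = Posz m.
      by move: m; apply: psum_eq => // m; lia.
    rewrite count ?(ltnW kn) // (eq_bigr (fun j : 'I_n => if (j < k.+1)%N then 1 else 0)).
      by rewrite -big_mkcond count //; lia.
    by move=> j _; rewrite ltnS; case: leqP.
  have xk : (x <= k)%N by have := xE x; have := c0 x; rewrite eqxx; lia.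
  have -> : l k = x.
    rewrite /l; case: pickP => [j /andP[jk /eqP cj]|/(_ x)] /=.
      by have := xE j; rewrite cj jk; case: eqVneq => // ->.
    by have := xE x; rewrite eqxx xk /=; lia.
  split=> // j; have := xE j; rewrite -(inj_eq val_inj) /=; lia.
have AE : A = asm_of n l.
  apply/matrixP => i j; rewrite mxE.
  have [lk cj] := cE _ (ltn_ord i).
  have cS : c i.+1 j = c i j + A i j by rewrite /c psumS.
  move: (ltn_ord i); rewrite leq_eqVlt => /predU1P[iE|iS].
    move: (cS) (cj j); rewrite iE cn ln; have := ltn_ord j; lia.
  by have [lk' cj'] := cE _ iS; have := cj j; have := cj' j; lia.
exists l => //; split=> // i ik.
  by move: ik; rewrite leq_eqVlt => /predU1P[->|/cE[]//]; rewrite ln.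
(* If [l i.+1 < l i], the prefix of row [i] ending at column [l i.+1] would sum to -1. *)
rewrite leqNgt; apply/negP => lt.
have [lk _] := cE _ ik.
have := Apr (Ordinal ik) (l i.+1).+1.
rewrite AE asm_of_row_psum /=; lia.
Qed.

(** * Permutation matrices and pattern avoidance *)

Lemma perm_mx_is_asm (n : nat) (s : 'S_n) : is_asm (perm_mx s : 'M[int]_n).
Proof.
have pE i j : (perm_mx s : 'M[int]_n) i j = Posz (s i == j) by rewrite !mxE; case: eqP.
have sr i : \sum_j (perm_mx s : 'M[int]_n) i j = 1.
  rewrite (bigD1 (s i)) //= pE eqxx big1 ?addr0 // => j /negbTE.
  by rewrite pE eq_sym => ->.
have sc j : \sum_i (perm_mx s : 'M[int]_n) i j = 1.
  rewrite (bigD1 ((s^-1)%g j)) //= pE permKV eqxx big1 ?addr0 // => i ij.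
  by rewrite pE (can2_eq (permK s) (permKV s)) (negbTE ij).
have bound (F : 'I_n -> int) k :
    (forall j, 0 <= F j) -> \sum_j F j = 1 -> 0 <= psum F k <= 1.
  move=> F0 <-; rewrite /psum sumr_ge0 //=.
  rewrite [leRHS](bigID [pred j : 'I_n | (j < k)%N]) /= lerDl.
  exact: sumr_ge0.
by apply/is_asm_psum; split=> // i k; apply: bound => // j; rewrite pE.
Qed.

(** If [s k >= k + 2], at most [k] of the [s k] smaller values occur before position [k], so two
    occur after it. Together with [s k] they form a 312 or a 321. *)
Lemma avoids_hessenberg (n : nat) (s : 'S_n) :
  avoids s [:: 3; 1; 2]%N -> avoids s [:: 3; 2; 1]%N ->
  forall k : 'I_n, (s k <= k.+1)%N.
Proof.
move=> h312 h321 k; rewrite leqNgt; apply/negP => sk.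
pose S := [set x : 'I_n | (k < x)%N && (s x < s k)%N].
have cardlt (a : 'I_n) : #|[set x : 'I_n | (x < a)%N]| = a.
  rewrite cardsE -sum1_card (big_ord_narrow_cond (P := predT)) ?(ltnW (ltn_ord a)) //.
  by move=> ?; rewrite sum1_card card_ord.
have S2 : (1 < #|S|)%N.
  have sub : s @^-1: [set y : 'I_n | (y < s k)%N]
             \subset [set x : 'I_n | (x < k)%N] :|: S.
    apply/fintype.subsetP => x; rewrite !inE.
    by case: (ltngtP x k) => // /val_inj ->; rewrite ltnn.
  have := subset_leq_card sub.
  rewrite (on_card_preimset (onW_bij _ (injF_bij (@perm_inj _ s)))) cardlt.
  have := leq_card_setU [set x : 'I_n | (x < k)%N] S; rewrite cardlt.
  move=> h1 h2; have := leq_trans h2 h1; lia.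
have [x [y [+ + xy]]] := card_gt1P S2.
wlog {xy} xy : x y / (x < y)%N => [W|].
  move: (xy); rewrite -(inj_eq val_inj) /= neq_ltn => /orP[xy'|yx] Sx Sy.
    exact: (W x y).
  exact: (W y x).
rewrite !inE => /andP[kx sx] /andP[ky sy].
pose f (a : 'I_3) := nth k [:: k; x; y] a.
have mono (a b : 'I_3) : (a < b)%N -> (f a < f b)%N.
  by case: a b => [[|[|[|?]]] ?] [[|[|[|?]]] ?] //= _; apply: ltn_trans kx xy.
have sxy : s x != s y by rewrite (inj_eq perm_inj) -(inj_eq val_inj) /= neq_ltn xy.
move: sxy; rewrite -(inj_eq val_inj) /= neq_ltn => /orP[sxy|syx].
- apply: h312; exists f; split=> // -[[|[|[|?]]] ?] [[|[|[|?]]] ?] //=; rewrite /f /=; lia.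
- apply: h321; exists f; split=> // -[[|[|[|?]]] ?] [[|[|[|?]]] ?] //=; rewrite /f /=; lia.
Qed.

(** * Locality of removals, and zeros above the superdiagonal *)

Lemma entry_set_entry (n : nat) (A : 'M[int]_n) (p q : cell n) (x : int) :
  entry (set_entry A p x) q = if q == p then x else entry A q.
Proof. by rewrite /entry mxE -surjective_pairing. Qed.

(* [B] arises from [A] by writing 0s and 1s weakly southwest of [p]. *)
Definition rewrites_sw (n : nat) (p : cell n) (A B : 'M[int]_n) : Prop :=
  (forall q, ~~ weakly_sw q p -> entry B q = entry A q) /\
  (forall q, entry B q = -1 -> entry A q = -1).

Lemma rewrites_sw_set (n : nat) (p q : cell n) (A B : 'M[int]_n) (x : int) :
  weakly_sw q p -> x != -1 -> rewrites_sw p A B ->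
  rewrites_sw p A (set_entry B q x).
Proof.
move=> qp x1 [outE negE]; split=> r; rewrite entry_set_entry; case: eqP => [->|_].
- by rewrite qp.
- exact: outE.
- by move=> xE; rewrite xE eqxx in x1.
- exact: negE.
Qed.

Lemma rewrites_sw_shift (n : nat) (p : cell n) (A B : 'M[int]_n) (r : 'I_n)
    (s : seq (cell n)) :
  (p.1 <= r)%N -> all (fun q => weakly_sw q p) s -> rewrites_sw p A B ->
  rewrites_sw p A (shift_ones B r s).
Proof.
elim: s r B => //= q s IHs r B pr /andP[qp sp] AB.
apply: IHs => //; first by case/andP: qp.
do 2![apply: rewrites_sw_set => //].
by rewrite /weakly_sw /= pr; case/andP: qp.
Qed.

Lemma involved_sw (n : nat) (A : 'M[int]_n) (p q : cell n) :
  involved A p q -> weakly_sw q p.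
Proof.
case/existsP=> i0 /existsP[j0 /and3P[/and3P[pi _ _] /and3P[jp _ _]]].
case/or3P=> [/eqP->|/eqP->|/andP[/and3P[]] //]; rewrite /weakly_sw /=; lia.
Qed.

Lemma sw_remove_rewrites (n : nat) (A : 'M[int]_n) (p : cell n) :
  rewrites_sw p A (sw_remove A p).
Proof.
rewrite /sw_remove; apply: rewrites_sw_set => //.
  by rewrite /weakly_sw !leqnn.
have : all (fun q => weakly_sw q p) (involved_seq A p).
  apply/allP => q; rewrite mem_sort mem_filter => /andP[qp _].
  exact: involved_sw qp.
case: involved_seq => //= q s /andP[qp sp].
by apply: rewrites_sw_shift => //; [case/andP: qp|apply: rewrites_sw_set].
Qed.

(** Stands in for [is_asm] along a run of removals: its persistence follows from locality alone. *)
Definition ones_east (n : nat) (A : 'M[int]_n) : Prop :=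
  forall i j, A i j = -1 -> exists2 j' : 'I_n, (j < j')%N & A i j' = 1.

(** If the 1 east of a surviving -1 were touched, that -1 would lie weakly southwest of [p].
    Removability then makes it [p] itself, which has been cleared. *)
Lemma ones_east_sw_remove (n : nat) (A : 'M[int]_n) (p : cell n) :
  removable A p -> ones_east A -> ones_east (sw_remove A p).
Proof.
move=> /andP[_ /forallP rp] eA i j; have [outE negE] := sw_remove_rewrites A p.
move=> Bij; have Aij := negE (i, j) Bij.
have [j' /= jj' Aij'] := eA _ _ Aij; exists j' => //.
rewrite -Aij'; apply: (outE (i, j')); apply/negP; rewrite /weakly_sw /= => sw.
have := rp (i, j); rewrite Aij /= /weakly_sw /=.
have -> /= : (p.1 <= i)%N && (j <= p.2)%N by lia.
move=> /eqP pE; move: Bij.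
by rewrite -[sw_remove A p i j]/(entry _ (i, j)) entry_set_entry pE eqxx.
Qed.

(* A 1 above the superdiagonal can only be destroyed by a -1 to its northeast,
   which has a surviving 1 to its east. *)
Lemma hessenberg_sw_remove (n : nat) (A : 'M[int]_n) (p : cell n) :
  entry A p = -1 -> ones_east A ->
  (exists2 q : cell n, (q.1.+1 < q.2)%N & entry A q = 1) ->
  exists2 q : cell n, (q.1.+1 < q.2)%N & entry (sw_remove A p) q = 1.
Proof.
move=> Ap eA [q qh Aq]; have [outE _] := sw_remove_rewrites A p.
have [qp|qp] := boolP (weakly_sw q p); last by exists q => //; rewrite outE.
have [j pj Aj] := eA _ _ Ap.
exists (p.1, j) => /=; first by move: qp; rewrite /weakly_sw; lia.
by rewrite outE // /weakly_sw /=; lia.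
Qed.

Lemma sw_key_hessenberg (n : nat) (A B : 'M[int]_n) :
  sw_key A B -> ones_east A -> hessenberg B ->
  forall q : cell n, (q.1.+1 < q.2)%N -> entry A q <> 1.
Proof.
elim=> {A B} [A _ _ hA q qh|A B p rp _ IH eA hB q qh Aq].
  by rewrite /entry hA.
have [|r rh Br] := @hessenberg_sw_remove n A p _ eA (ex_intro2 _ _ q qh Aq).
  by case/andP: rp => /eqP.
exact: (IH (ones_east_sw_remove rp eA) hB r rh).
Qed.

Lemma asm_key_hessenberg (n : nat) (A B : 'M[int]_n) :
  is_asm A -> sw_key A B -> hessenberg B -> hessenberg A.
Proof.
move=> asmA AB hB i j ij.
have eA : ones_east A by move=> ? ?; apply: asm_one_east.
have no1 := sw_key_hessenberg AB eA hB.
have [A01 _ _ _ _] := asmA; have := A01 i j; rewrite !inE => /or3P[]/eqP // Aij.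
  by case: (no1 (i, j) ij).
(* A -1 above the superdiagonal has a 1 further east, which is above the superdiagonal too. *)
have [j' jj' Aij'] := eA _ _ Aij.
by case: (no1 (i, j')) => //=; lia.
Qed.

(** * The effect of a removal on the sequence [l] *)

Lemma perm_eq2 (T : eqType) (a b : T) (s : seq T) :
  perm_eq s [:: a; b] -> s = [:: a; b] \/ s = [:: b; a].
Proof.
move=> sab; have := perm_size sab; case: s sab => [|x [|y []]] // sab _.
have := perm_mem sab x; rewrite !inE eqxx => /esym/orP[]/eqP xE.
- by left; move: sab; rewrite xE perm_cons => /perm_small_eq -> .
- right; move: sab; rewrite perm_sym -[[:: a; b]]/([:: a] ++ [:: b]) perm_catC /=.
  by rewrite xE perm_cons => /perm_small_eq <-.
Qed.

Lemma asm_of_neg (n : nat) (l : nat -> nat) (p : cell n) :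
  admissible n l -> entry (asm_of n l) p = -1 ->
  [/\ p.2 = l p.1.+1 :> nat, (l p.1 < p.2)%N & (p.2 <= p.1)%N].
Proof.
move=> [ln lle lS]; rewrite /entry mxE => Ap.
by have := lS _ (ltn_ord p.1); have := lle _ (ltn_ord p.1); split; lia.
Qed.

(** A -1 in row [i] marks a jump of [l] to its column, off the diagonal. By monotonicity a later
    jump lands strictly further east, so no other -1 lies weakly southwest. *)
Lemma asm_of_removable (n : nat) (l : nat -> nat) (p : cell n) :
  admissible n l -> entry (asm_of n l) p = -1 -> removable (asm_of n l) p.
Proof.
move=> al; case: p => i j Ap; rewrite /removable Ap eqxx; apply/forallP => -[i' j'].
apply/implyP => /andP[/eqP Aq /andP[/= ii' jj']].
have [/= pE pl pd] := asm_of_neg al Ap; have [/= qE ql qd] := asm_of_neg al Aq.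
have jE : j' = j :> nat.
  have := admissible_le al (i := i.+1) (j := i'.+1); have := ltn_ord i'; lia.
have iE : i' = i :> nat.
  have := admissible_le al (i := i.+1) (j := i'); have := ltn_ord i'; lia.
by apply/eqP; congr (_, _); apply: val_inj.
Qed.

Definition lower (l : nat -> nat) (i i0 k : nat) : nat :=
  if (i < k <= i0)%N then l i else l k.

Lemma lower_admissible (n : nat) (l : nat -> nat) (i i0 : nat) :
  admissible n l -> (i0 < n)%N -> admissible n (lower l i i0).
Proof.
move=> al i0n; have [ln lle lS] := al; have mono := admissible_le al.
split=> [|k kn|k kn]; rewrite /lower.
- by rewrite ln; case: ifP => //; lia.
- by case: ifP => [?|_]; [have := lle i; lia | exact: lle].
- have : k = i -> l k = l i by move=> ->.
  have := lS k kn; have := mono i k.+1.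
  by case: ifP; case: ifP; lia.
Qed.

(** Only two 1s are involved, at [(i0, j)] and [(i, l i)]; the rectangle they span contains no other
    1. The removal replaces both by a single 1 at [(i0, l i)]. *)
Lemma sw_remove_asm_of (n : nat) (l : nat -> nat) (i j : 'I_n) :
  admissible n l -> asm_of n l i j = -1 ->
  exists i0, [/\ (i < i0 < n)%N, forall k, (i < k <= i0)%N -> l k = j &
    sw_remove (asm_of n l) (i, j) = asm_of n (lower l i i0)].
Proof.
move=> al Ap; have [/= pE pl pd] := asm_of_neg al (p := (i, j)) Ap.
have [ln lle lS] := al; have mono := admissible_le al.
have pn : (i.+1 < n)%N.
  have := ltn_ord i; rewrite leq_eqVlt => /predU1P[E|//].
  by move: pE; rewrite E ln; have := ltn_ord j; lia.
have [i0 /andP[i0n /eqP li0] i0max] :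
    {i0 | (i0 < n)%N && (l i0 == j) & forall k, (k < n)%N && (l k == j) -> (k <= i0)%N}.
  have ex : exists k, (k < n)%N && (l k == j) by exists i.+1; rewrite pn pE eqxx.
  have ub k : (k < n)%N && (l k == j) -> (k <= n)%N by lia.
  by case: (ex_maxnP ex ub) => i0 Pi0 m; exists i0.
have pi0 : (i < i0)%N by apply: i0max; rewrite pn pE eqxx.
have lE k : (i < k <= i0)%N -> l k = j.
  move=> k_in; have := mono i.+1 k; have := mono k i0; lia.
(* This keeps the 1 at [(i0, j)] from being cancelled. It holds by maximality of [i0], or by
   [l n = n] when [i0.+1 = n]. *)
have li0S : (j < l i0.+1)%N.
  have := lS _ i0n; rewrite li0 leq_eqVlt => /predU1P[E|//].
  have := i0max i0.+1; have := lle _ i0n.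
  have : i0.+1 = n -> l i0.+1 = n by move=> ->.
  have := ltn_ord j; lia.
exists i0; split; rewrite ?pi0 //.
have ltl : (l i < n)%N by have := ltn_ord j; lia.
pose a : cell n := (Ordinal i0n, j); pose b : cell n := (i, Ordinal ltl).
have rowE (c : 'I_n) : (c < j)%N -> asm_of n l i c = Posz (c == l i :> nat).
  by move=> cj; rewrite mxE; lia.
have colE (r : 'I_n) : (i < r <= i0)%N -> asm_of n l r j = Posz (r == i0 :> nat).
  move=> r_in; rewrite mxE lE //; case: (eqVneq (r : nat) i0) => [->|ri0].
    by lia.
  by rewrite (lE r.+1); lia.
have southE x : nearest_south (asm_of n l) (i, j) x = (x == Ordinal i0n).
  rewrite -(inj_eq val_inj) /=; apply/and3P/eqP => /= [[ix Ax /forallP xmin]|xE].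
    case: (ltngtP x i0) => // xi0; first by move: Ax; rewrite colE; lia.
    by have := xmin (Ordinal i0n); rewrite /= pi0 xi0 colE /= ?pi0 ?leqnn ?eqxx.
  rewrite xE pi0 colE xE ?pi0 ?leqnn ?eqxx; split=> //.
  by apply/forallP => r; apply/implyP => r_in; rewrite colE; lia.
have westE x : nearest_west (asm_of n l) (i, j) x = (x == Ordinal ltl).
  rewrite -(inj_eq val_inj) /=; apply/and3P/eqP => /= [[xj Ax _]|xE].
    by move: Ax; rewrite rowE; lia.
  rewrite xE pl rowE xE ?eqxx //; split=> //.
  by apply/forallP => c; apply/implyP => c_in; rewrite rowE; lia.
have invE q : involved (asm_of n l) (i, j) q = (q \in [:: a; b]).
  rewrite !inE; apply/idP/idP.
    case/existsP=> x /existsP[y]; rewrite southE westE => /and3P[/eqP-> /eqP->].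
    rewrite -/a -/b => /or3P[->|->|]; rewrite ?orbT //.
    case: q => r c /and3P[/and3P[/eqP + _ _] /=]; rewrite /entry /= => Arc r_in c_in.
    rewrite !xpair_eqE -!(inj_eq val_inj) /=.
    case: (eqVneq (r : nat) i) => [/val_inj rE|ri].
      move: Arc; rewrite rE; case: (eqVneq (c : nat) j) => [/val_inj ->|cj].
        by rewrite Ap.
      by rewrite rowE; lia.
    case: (eqVneq (c : nat) j) => [/val_inj cE|cj].
      by move: Arc; rewrite cE colE; lia.
    move: Arc; rewrite mxE lE; last by lia.
    have := mono i.+1 r.+1; have := ltn_ord r; lia.
  move=> q_ab; apply/existsP; exists (Ordinal i0n); apply/existsP; exists (Ordinal ltl).
  rewrite southE westE !eqxx /= -/a -/b orbA [(q == b) || _]orbC.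
  by rewrite q_ab.
have seqE : involved_seq (asm_of n l) (i, j) = [:: a; b].
  have : perm_eq (involved_seq (asm_of n l) (i, j)) [:: a; b].
    rewrite perm_sort; apply: uniq_perm.
    - by rewrite filter_uniq ?enum_uniq.
    - by rewrite /= inE xpair_eqE -!(inj_eq val_inj) /=; lia.
    - by move=> q; rewrite mem_filter mem_enum andbT invE.
  case/perm_eq2 => // sE.
  (* The order [b, a] is excluded because [l i < j]: the list runs from east to west. *)
  have : sorted (fun q r : cell n => (r.2 <= q.2)%N) (involved_seq (asm_of n l) (i, j)).
    by apply: sort_sorted => q r; apply: leq_total.
  by rewrite sE /= andbT; lia.
rewrite /sw_remove seqE /=; apply/matrixP => t c; rewrite !mxE /lower.
rewrite !xpair_eqE -!(inj_eq val_inj) /=.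
have iNi0 : (i == i0 :> nat) = false by lia.
case: (eqVneq (t : nat) i) => [/val_inj ->|ti] /=.
  rewrite iNi0 ltnn ltnSn pi0 -pE /=.
  by case: (eqVneq (c : nat) j) => ?; case: (eqVneq (c : nat) (l i)) => ?; lia.
case: (eqVneq (t : nat) i0) => [->|ti0] /=.
  rewrite pi0 leqnn ltnn andbF li0.
  by case: (eqVneq (c : nat) j) => ?; case: (eqVneq (c : nat) (l i)) => ?; lia.
(* Strictly between rows [i] and [i0] the two terms in [l] cancel, before and after lowering. *)
case: ifP => [t_in|t_out].
  have tS_in : (i < t.+1 <= i0)%N by lia.
  by rewrite tS_in (lE t) // (lE t.+1) //; lia.
by have -> : (i < t.+1 <= i0)%N = false by lia.
Qed.

Lemma eq_asm_of (n : nat) (l l' : nat -> nat) :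
  (forall k, (k <= n)%N -> l k = l' k) -> asm_of n l = asm_of n l'.
Proof.
move=> ll'; apply/matrixP => i j; rewrite !mxE.
by rewrite ll' ?(ltnW (ltn_ord i)) // ll'.
Qed.

(** On the run, both the old value [j] and the new value [l i] are at most [i < k], so [k] is fixed
    neither before nor after. *)
Lemma lower_fixpoint (n : nat) (l : nat -> nat) (i i0 j : nat) :
  admissible n l -> (i < i0 < n)%N -> (j <= i)%N ->
  (forall k, (i < k <= i0)%N -> l k = j) ->
  forall k, (lower l i i0 k == k) = (l k == k).
Proof.
move=> [_ lle _] i0n ji lE k; rewrite /lower; case: ifP => // k_in.
by rewrite (lE k k_in); have := lle i; lia.
Qed.

Lemma sw_key_asm_of (n : nat) (A B : 'M[int]_n) : sw_key A B ->
  forall l, admissible n l -> A = asm_of n l ->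
  exists l', [/\ admissible n l', B = asm_of n l' &
    forall k, (l' k == k) = (l k == k)].
Proof.
elim=> {A B} [A _ l al ->|A B [i j] rp _ IH l al AE]; first by exists l.
have Ap : asm_of n l i j = -1.
  by rewrite -AE; case/andP: rp => /eqP.
have [_ /= _ jd] := asm_of_neg al (p := (i, j)) Ap.
have [i0 [i0n lE remE]] := sw_remove_asm_of al Ap.
have al' := lower_admissible i al (proj2 (andP i0n)).
have [|l' [al'' BE fixE]] := IH _ al'; first by rewrite AE.
exists l'; split=> // k.
by rewrite fixE (lower_fixpoint al i0n jd lE).
Qed.

(** * Terminal sequences and existence of the key *)

Definition terminal (n : nat) (l : nat -> nat) : Prop :=
  forall i, (i < n)%N -> l i.+1 = l i \/ l i.+1 = i.+1.

Lemma no_neg_terminal (n : nat) (l : nat -> nat) : admissible n l ->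
  (forall p, entry (asm_of n l) p <> -1) -> terminal n l.
Proof.
move=> [ln lle lS] noneg i ik.
have [|ne1] := eqVneq (l i.+1) (l i); first by left.
have [|ne2] := eqVneq (l i.+1) i.+1; first by right.
have lk : (l i.+1 < n)%N by have := lle _ ik; lia.
by case: (noneg (Ordinal ik, Ordinal lk)); rewrite /entry mxE /=; lia.
Qed.

(** Below [n], each step either stays or jumps to the diagonal, and the fixed points tell which. *)
Lemma terminal_unique (n : nat) (l l' : nat -> nat) :
  admissible n l -> terminal n l -> admissible n l' -> terminal n l' ->
  (forall k, (k < n)%N -> (l k == k) = (l' k == k)) ->
  forall k, (k <= n)%N -> l k = l' k.
Proof.
move=> [ln lle _] tl [ln' lle' _] tl' fixE; elim=> [_|k IHk kn].
  by have := lle 0%N isT; have := lle' 0%N isT; lia.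
move: (kn); rewrite leq_eqVlt => /predU1P[->|kSn]; first by rewrite ln ln'.
have := fixE _ kSn; have := IHk (ltnW kn).
by have := lle _ (ltnW kn); case: (tl k kn); case: (tl' k kn); lia.
Qed.

(** Removals terminate because each one decreases the sum of the [l k], strictly at [k = i.+1]. *)
Lemma sw_key_exists (n : nat) (l : nat -> nat) : admissible n l ->
  exists l', [/\ admissible n l', terminal n l', sw_key (asm_of n l) (asm_of n l')
    & forall k, (l' k == k) = (l k == k)].
Proof.
have [N] := ubnP (\sum_(k < n) l k)%N.
elim: N l => // N IHN l sumN al.
have : (exists i j : 'I_n, asm_of n l i j = -1) \/
    (forall p, entry (asm_of n l) p <> -1).
  have [/existsP[[i j] /eqP Ap]|noneg] :=
    boolP [exists p : cell n, entry (asm_of n l) p == -1]; first by left; exists i, j.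
  by right=> p /eqP Ap; case/existsP: noneg; exists p.
case=> [[i [j Ap]]|noneg]; last first.
  by exists l; split=> //; [exact: no_neg_terminal | exact: sw_key_done].
have [_ /= lj jd] := asm_of_neg al (p := (i, j)) Ap.
have [i0 [i0n lE remE]] := sw_remove_asm_of al Ap.
have al' := lower_admissible i al (proj2 (andP i0n)).
have [|l' [al'' tl' key fixE]] := IHN _ _ al'.
  have iSn : (i.+1 < n)%N by lia.
  rewrite ltnS in sumN; apply: leq_trans sumN.
  rewrite (bigD1 (Ordinal iSn)) //= [ltnRHS](bigD1 (Ordinal iSn)) //=.
  have lt1 : (lower l i i0 i.+1 < l i.+1)%N.
    rewrite /lower ltnSn /= (_ : (i < i0)%N) ?(lE i.+1) //; lia.
  rewrite -addSn leq_add // leq_sum // => k _; rewrite /lower.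
  by case: ifP => // k_in; rewrite (lE k k_in) ltnW.
exists l'; split=> // [|k]; last by rewrite fixE (lower_fixpoint al i0n jd lE).
by apply: (sw_key_step (p := (i, j))); [exact: asm_of_removable | rewrite remE].
Qed.

(** Any run of removals preserves the fixed points. Conversely, some run ends at a terminal
    sequence, which the fixed points identify with [l]. *)
Lemma asms_with_sw_key_asm_of (n : nat) (pi : 'S_n) (l : nat -> nat) :
  admissible n l -> perm_mx pi = asm_of n l -> forall A : 'M[int]_n,
  asms_with_sw_key pi A <->
  exists l', [/\ admissible n l', A = asm_of n l' &
    forall k, (k < n)%N -> (l' k == k) = (l k == k)].
Proof.
move=> al piE A.
have tl : terminal n l.
  by apply: no_neg_terminal => // p; rewrite -piE /entry !mxE; case: eqP.
split=> [[asmA keyA]|[l' [al' AE fixE]]].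
  have hpi : hessenberg (perm_mx pi : 'M[int]_n).
    case: al => _ lle lS; rewrite piE => i j ij; rewrite mxE.
    by have := lle _ (ltnW (ltn_ord i)); have := lle _ (ltn_ord i); lia.
  have hA := asm_key_hessenberg asmA keyA hpi.
  have [l' al' AE] := hessenberg_asm asmA hA.
  exists l'; split=> // k kn.
  have [l2 [al2 piE2 <-]] := sw_key_asm_of keyA al' AE.
  by rewrite (asm_of_inj al2 al) // -piE2.
split; first by rewrite AE; apply: asm_of_is_asm.
have [l2 [al2 tl2 key fixE2]] := sw_key_exists al'.
rewrite AE piE (_ : asm_of n l = asm_of n l2) //.
apply/eq_asm_of/terminal_unique => // k kn.
by rewrite fixE2 fixE.
Qed.

(** * Enumerating sequences with prescribed fixed points *)

(* The lists [l k; l k.+1; ...] that can follow the value [l k.-1 = y], where [bs]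
   prescribes which of these indices are fixed by [l]. *)
Fixpoint tails (k y : nat) (bs : seq bool) : seq (seq nat) :=
  if bs is b :: bs' then
    [seq x :: s | x <- if b then [:: k] else iota y (k - y), s <- tails k.+1 x bs']
  else [:: [::]].

Lemma cons_tails (k y : nat) (b : bool) (bs : seq bool) (x : nat) (s : seq nat) :
  (y <= k)%N ->
  (x :: s \in tails k y (b :: bs))
  = [&& (y <= x <= k)%N, (x == k) == b & s \in tails k.+1 x bs].
Proof.
move=> yk; rewrite andbA.
have -> : (y <= x <= k)%N && ((x == k) == b)
          = (x \in if b then [:: k] else iota y (k - y)).
  by case: b; rewrite ?inE ?mem_iota; lia.
apply/allpairsPdep/andP => [[x' [s' [? ? [-> ->]]]] //|[? ?]].
by exists x, s.
Qed.

Lemma tails_uniq (k y : nat) (bs : seq bool) : uniq (tails k y bs).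
Proof.
elim: bs k y => //= b bs IHbs k y; apply: allpairs_uniq_dep => //.
- by case: b; rewrite ?iota_uniq.
- by move=> [? ?] [? ?] _ _ [-> ->].
Qed.

Lemma mem_tails (k y : nat) (bs : seq bool) (s : seq nat) (d : nat) :
  (y <= k)%N ->
  s \in tails k y bs <->
  size s = size bs /\
  forall t, (t < size bs)%N ->
    [/\ (nth d (y :: s) t <= nth d s t)%N, (nth d s t <= k + t)%N &
        (nth d s t == k + t)%N = nth false bs t].
Proof.
elim: bs k y s => [|b bs IHbs] k y s yk.
  by rewrite inE; split=> [/eqP->|[/size0nil->]].
case: s => [|x s].
  split=> [|[]//]; by case/allpairsPdep => x [s [_ _]].
rewrite cons_tails //; split.
  case/and3P=> /andP[yx xk] /eqP xb /(IHbs _ _ _ (leqW xk))[/= -> H].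
  split=> // -[_|t]; first by rewrite addn0.
  by rewrite ltnS => /H; rewrite addSnnS.
case=> -[sz] H; have [/= yx xk xb] := H 0%N isT; rewrite addn0 in xk xb.
rewrite yx xk xb eqxx /=; apply/IHbs; first exact: leqW.
by split=> // t tb; have := H t.+1 tb; rewrite addSnnS.
Qed.

(* The count depends on [k] and [y] only through [h = k - y]. *)
Fixpoint tails_count (h : nat) (bs : seq bool) : nat :=
  if bs is b :: bs' then
    if b then tails_count 1 bs' else \sum_(2 <= t < h.+2) tails_count t bs'
  else 1.

Lemma size_tails (k y : nat) (bs : seq bool) :
  (y <= k)%N -> size (tails k y bs) = tails_count (k - y) bs.
Proof.
elim: bs k y => //= b bs IHbs k y yk; rewrite size_allpairs_dep sumnE big_map.
case: b; first by rewrite big_seq1 IHbs // subSnn.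
(* As [x] runs up from [y] to [k - 1], the next gap [k.+1 - x] runs down from [h + 1] to 2; hence
   the reversal and the shift by 2. *)
rewrite -[iota y _]/(index_iota y k) big_nat_rev (big_addn 0 _ 2) !subSS subn0.
rewrite -{1}[y]add0n big_addn; apply: eq_big_nat => t tk.
by rewrite IHbs; [congr tails_count; lia | lia].
Qed.

(** * Ballot and Catalan numbers *)

(** Ballot numbers, arising as [tails_count] for [r] consecutive non-fixed indices. *)
Fixpoint ballot (r h : nat) : nat :=
  if r is r'.+1 then \sum_(2 <= t < h.+2) ballot r' t else 1.

Lemma ballot_recr (r h : nat) :
  ballot r.+1 h.+1 = (ballot r.+1 h + ballot r h.+2)%N.
Proof. by rewrite /= big_nat_recr. Qed.

(** The reflection formula, a difference of two binomials, in additive form to avoid truncated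
    subtraction. At [h = 0] the two binomials agree by symmetry; otherwise Pascal's rule matches
    [ballot_recr]. *)
Lemma ballotE (r h : nat) :
  (ballot r.+1 h + 'C(r.*2 + h.+1, r))%N = 'C(r.*2 + h.+1, r.+1).
Proof.
elim: r h => [|r IHr] h.
  by rewrite bin0 bin1 /= sum_nat_const_nat; lia.
elim: h => [|h IHh].
  rewrite {1}/ballot big_geq // -/ballot add0n.
  by rewrite -[RHS]bin_sub; [congr 'C(_, _); lia | lia].
rewrite ballot_recr; have := IHr h.+2.
rewrite !doubleS !addSn !addnS in IHh *; rewrite !binS in IHh *; lia.
Qed.

Lemma ballot_catalan (r : nat) : ballot r 1 = catalan r.
Proof.
case: r => [|r]; first by rewrite /catalan bin0.
have := ballotE r 1; have := mul_bin_left r.+1.*2 r.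
rewrite /catalan addn2 -doubleS (_ : r.+1.*2 - r = r.+2)%N; last by lia.
move: (ballot _ _) 'C(_, r.+1) 'C(_, r) => b c d E1 E2.
(* Eliminate [d] from [b + d = c] and [(r + 1) c = (r + 2) d]. *)
have -> : c = (r.+2 * b)%N by nia.
by rewrite mulKn.
Qed.

(** The fixed-point pattern of a direct sum of [w_m]: only the first index of each block is
    fixed. *)
Definition blocks (ms : seq nat) : seq bool :=
  flatten [seq true :: nseq m.-1 false | m <- ms].

(** The prefix [nseq r false] is the rest of the current block. Each [true] resets the gap to 1, so
    the counts of the blocks multiply. *)
Lemma tails_count_blocks (r h : nat) (ms : seq nat) :
  tails_count h (nseq r false ++ blocks ms)
  = (ballot r h * \prod_(m <- ms) catalan m.-1)%N.
Proof.
elim: ms r h => [|m ms IHms] r h.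
  rewrite big_nil muln1 cats0.
  by elim: r h => //= r IHr h; apply: eq_bigr => t _.
elim: r h => [|r IHr] h /=; last by rewrite big_distrl; apply: eq_bigr => t _.
by rewrite IHms ballot_catalan big_cons mul1n.
Qed.

Lemma blocks_exists (bs : seq bool) :
  exists r ms, bs = nseq r false ++ blocks ms.
Proof.
elim: bs => [|[] bs [r [ms ->]]]; first by exists 0%N, [::].
  by exists 0%N, (r.+1 :: ms).
by exists r.+1, ms.
Qed.

Lemma mkseq_blocks (f : nat -> bool) (ms : seq nat) :
  all (leq 1) ms ->
  (forall i u, (i < size ms)%N -> (u < nth 0 ms i)%N ->
     f (sumn (take i ms) + u)%N = (u == 0%N)) ->
  mkseq f (sumn ms) = blocks ms.
Proof.
elim: ms f => //= m ms IHms f /andP[m0 msP] fE.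
rewrite /blocks /= /mkseq iotaD map_cat -cat_cons; congr (_ ++ _).
  case: m m0 fE => //= m _ fE; congr cons; first exact: (fE 0%N 0%N).
  apply: (@eq_from_nth _ false); rewrite !size_map ?size_iota ?size_nseq // => t tm.
  by rewrite nth_nseq tm (nth_map 0%N) ?size_iota // nth_iota // (fE 0%N).
rewrite add0n -[m in iota m]addn0 iotaDl -map_comp.
apply: (IHms (f \o addn m)) => // i u ilt ult.
by have := fE i.+1 u ilt ult; rewrite /= addnA.
Qed.

(** * Cardinality of the set of ASMs with a given key *)

Local Open Scope classical_set_scope.
Local Open Scope card_scope.

Lemma card_eq_uniq_seq (T : eqType) (X : set T) (L : seq T) :
  uniq L -> (forall x, X x <-> x \in L) -> X #= `I_(size L).
Proof.
move=> uL XL; apply/card_set_bijP; exists (index^~ L); split=> [x|x y|k].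
- by move/XL; rewrite /mkset index_mem.
- by rewrite !inE => /XL xL /XL yL; apply: index_inj.
- case: L uL XL => [|x0 L] uL XL kL //; exists (nth x0 (x0 :: L) k).
    by apply/XL/mem_nth.
  by rewrite index_uniq.
Qed.

(** The default [n] of [nth n s] supplies the boundary value [l n = n]. *)
Lemma mem_tails_fixpoints (n : nat) (d : nat -> bool) (s : seq nat) :
  s \in tails 0 0 (mkseq d n) <->
  [/\ size s = n, admissible n (nth n s) &
      forall k, (k < n)%N -> (nth n s k == k) = d k].
Proof.
rewrite (mem_tails _ _ n (leqnn 0)) size_mkseq; split.
  move=> [sz H]; have sn : nth n s n = n by rewrite nth_default ?sz.
  split=> //; first split=> // i iN.
  - by move: iN; rewrite leq_eqVlt => /predU1P[->|/H[]//]; rewrite sn.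
  - have [_ ii _] := H i iN; move: (iN); rewrite leq_eqVlt.
    by case/predU1P=> [->|/H[]//]; rewrite sn; lia.
  - by move=> k kn; have [_ _] := H k kn; rewrite nth_mkseq.
move=> [sz [sn sle sS] sd]; split=> // t tn; split.
- case: t tn => [|t] tn //=; exact: (sS t (ltnW tn)).
- exact: (sle _ (ltnW tn)).
- by rewrite nth_mkseq // sd.
Qed.

Lemma card_asms_with_sw_key (n : nat) (pi : 'S_n) (l : nat -> nat) :
  admissible n l -> perm_mx pi = asm_of n l ->
  asms_with_sw_key pi #= `I_(tails_count 0 (mkseq (fun k => l k == k) n)).
Proof.
move=> al piE; set bs := mkseq _ n.
pose L := [seq asm_of n (nth n s) | s <- tails 0 0 bs].
have -> : tails_count 0 bs = size L by rewrite size_map size_tails.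
apply: card_eq_uniq_seq => [|A].
  rewrite map_inj_in_uniq ?tails_uniq // => s s'.
  move=> /mem_tails_fixpoints[sz as_ _] /mem_tails_fixpoints[sz' as'_ _] E.
  apply: (@eq_from_nth _ n) => [|k]; rewrite ?sz ?sz' //.
  exact: asm_of_inj E k.
rewrite (asms_with_sw_key_asm_of al piE); split.
  move=> [l' [al' AE fixE]].
  have l'E k : (k <= n)%N -> nth n (mkseq l' n) k = l' k.
    rewrite leq_eqVlt => /predU1P[->|kn]; last by rewrite nth_mkseq.
    by rewrite nth_default ?size_mkseq //; case: al'.
  apply/mapP; exists (mkseq l' n); last by rewrite AE; apply: eq_asm_of => k /l'E.
  apply/mem_tails_fixpoints; rewrite size_mkseq; split=> // [|k kn].
    case: al' => ln lle lS; split=> [|k kn|k kn].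
    - by rewrite l'E.
    - by rewrite l'E // lle.
    - by rewrite !l'E ?(ltnW kn) // lS.
  by rewrite l'E ?fixE // ltnW.
by case/mapP=> s /mem_tails_fixpoints[sz al' fixE] ->; exists (nth n s).
Qed.

(** * Direct sums of the permutations [w_m] *)

(** For [u = 0] the row [r] belongs to an earlier block, which gives 0; otherwise [r] has index
    [u - 1] in block [i], and [w_m] sends it to [u]. *)
Lemma mxdiag_wperm_superdiag (k : nat) (m : 'I_k -> nat) (i : 'I_k) (u : 'I_(m i))
    (r : 'I_(\sum_(i < k) m i)%N) :
  r.+1 = tagnat.Rank i u :> nat ->
  (\mxdiag_(i < k) perm_mx (wperm (m i)) : 'M[int]_(\sum_(i < k) m i)) r (tagnat.Rank i u)
  = Posz (u != 0%N :> nat).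
Proof.
have diagE i' (v : 'I_(m i')) :
    (\mxdiag_(i < k) perm_mx (wperm (m i)) : 'M[int]_(\sum_(i < k) m i))
      (tagnat.Rank i' v) (tagnat.Rank i u) =
    submxblock (\mxdiag_(i < k) perm_mx (wperm (m i))) i' i v u.
  by rewrite [RHS]mxE.
move=> rE; case: (posnP u) => [u0|u_gt0].
  rewrite -(tagnat.sig2K r) diagE mxblockK ifN ?mxE //; apply/eqP => sE.
  move: rE; rewrite (tagnat.rect r) tagnat.RankEsum.
  by move: (nat_of_ord (tagnat.sig2 r)) => v; rewrite sE; lia.
have u1m : (u.-1 < m i)%N by have := ltn_ord u; lia.
have -> : r = tagnat.Rank i (Ordinal u1m).
  by apply: ord_inj; move: rE; rewrite !tagnat.RankEsum /=; lia.
rewrite diagE mxblockK eqxx conform_mx_id !mxE permE.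
rewrite (_ : ordS _ = u) ?eqxx //.
by apply: val_inj; rewrite /= prednK // modn_small.
Qed.

(** Fixed points of [l] other than 0 can be read off the superdiagonal: its 1 is cancelled by
    [- e_(l c)] exactly when [c] is fixed. *)
Lemma asm_of_superdiag (n : nat) (l : nat -> nat) (r c : 'I_n) :
  admissible n l -> r.+1 = c :> nat ->
  asm_of n l r c = Posz (l c != c :> nat).
Proof.
move=> [_ lle _] rc; rewrite mxE -rc eqxx.
by have := lle r (ltnW (ltn_ord r)); lia.
Qed.

Lemma fixpoints_blocks (n k : nat) (m : 'I_k -> nat)
    (e : (\sum_(i < k) m i)%N = n) (l : nat -> nat) :
  admissible n l -> (forall i, (0 < m i)%N) ->
  asm_of n l = castmx (e, e) (\mxdiag_(i < k) perm_mx (wperm (m i))) ->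
  mkseq (fun j => l j == j) n = blocks [seq m i | i <- enum 'I_k].
Proof.
move=> al m_gt0 lE; set ms := [seq _ | _ <- _].
have -> : n = sumn ms by rewrite -e sumnE big_map big_enum.
apply: mkseq_blocks => [|i u]; first by apply/allP => _ /mapP[i _ ->].
rewrite size_map size_enum_ord => ik.
have -> : nth 0%N ms i = m (Ordinal ik).
  by rewrite (nth_map (Ordinal ik)) ?size_enum_ord // (nth_ord_enum _ (Ordinal ik)).
move=> um.
have -> : (sumn (take i ms) + u)%N = tagnat.Rank (Ordinal ik) (Ordinal um) :> nat.
  by rewrite tagnat.RankEsum take_map_enum sumnE big_map big_filter big_enum_cond.
set c := tagnat.Rank _ _; have ln := al; case: ln => _ lle _.
have cn : (c < n)%N by rewrite -e.
(* Column 0 has no superdiagonal entry; there [l 0 = 0] and [u = 0]. *)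
case: (posnP c) => [c0|c_gt0].
  have := lle 0%N isT; rewrite c0; have := tagnat.RankEsum (Ordinal um).
  by rewrite -/c c0 /=; lia.
have rn : (c.-1 < n)%N by lia.
have rcE : c.-1.+1 = c by rewrite prednK.
have := @asm_of_superdiag n l (Ordinal rn) (Ordinal cn) al rcE.
rewrite lE castmxE /=.
have -> : cast_ord (esym e) (Ordinal cn) = c by apply: val_inj.
by rewrite mxdiag_wperm_superdiag //=; lia.
Qed.

Lemma avoids_asm_of (n : nat) (pi : 'S_n) :
  avoids pi [:: 3; 1; 2]%N -> avoids pi [:: 3; 2; 1]%N ->
  exists2 l, admissible n l & perm_mx pi = asm_of n l.
Proof.
move=> h312 h321; apply: hessenberg_asm; first exact: perm_mx_is_asm.
move=> i j ij; rewrite !mxE; case: eqP => // piE.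
by have := avoids_hessenberg h312 h321 i; rewrite piE; lia.
Qed.

Theorem theorem5p5 (n : nat) (pi : 'S_n)
    (h312 : avoids pi [:: 3; 1; 2]%N) (h321 : avoids pi [:: 3; 2; 1]%N) :
  (exists ms : seq nat,
     asms_with_sw_key pi #= `I_(\prod_(m <- ms) catalan m)%N) /\
  (forall (k : nat) (m : 'I_k -> nat) (e : (\sum_(i < k) m i)%N = n),
     (forall i, (0 < m i)%N) ->
     perm_mx pi = castmx (e, e) (\mxdiag_(i < k) perm_mx (wperm (m i)))
       :> 'M[int]_n ->
     asms_with_sw_key pi #= `I_(\prod_(i < k) catalan (m i).-1)%N).
Proof.
have [l al piE] := avoids_asm_of h312 h321.
have cardE := card_asms_with_sw_key al piE; split.
  have [r [ms bsE]] := blocks_exists (mkseq (fun k => l k == k) n).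
  (* Index 0 is always fixed, so the pattern cannot start with [false]. *)
  have r0 : r = 0%N.
    have [_ lle _] := al; case: r bsE => //; case: n lle {al cardE pi h312 h321 piE} => // n lle r.
    by case=> /eqP; have := lle 0%N isT; lia.
  exists [seq m.-1 | m <- ms]; rewrite big_map.
  by move: cardE; rewrite bsE r0 (tails_count_blocks 0) mul1n.
move=> k m e m_gt0 mE; move: cardE.
rewrite (fixpoints_blocks al m_gt0 (e := e)) -?piE //.
by rewrite (tails_count_blocks 0) mul1n big_map big_enum.
Qed.
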